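(* Let $A:H\to H$ be a positive operator on a separable Hilbert space $H$. Let $H=H_1\oplus H_2$ be any orthogonal split, and fix any ordered orthonormal basis of $H_2$. Let $H_2^n$ denote the span of the first $n$ basis elements, and let $P^n:=P_{H_1}+P_{H_2^n}$ denote the orthogonal projection of $H$ onto $H_1\oplus H_2^n$. Then each of the positive operators $$A^n:=P^nAP^n,\qquad n=1,2,\ldots$$ is compatible with $H_2$, and $\mathcal{H}_1(A^n)$ converges to $\mathcal{H}_1(A)$ in the weak operator topology as $n\to\infty$, that is, $\mathcal{H}_1(A^n)h$ converges weakly to $\mathcal{H}_1(A)h$ for every $h\in H$.
   Context: A bounded symmetric operator $A$ on $H$ is positive if $\langle Ax,x\rangle\ge 0$ for all $x\in H$; $L_+(H)$ denotes the set of positive operators, and $X\leqq A$ means that $A-X$ is positive. $L(H)$ is the algebra of bounded linear operators on $H$ and $R(X)$ is the range of $X$. Shorted operator: for a closed subspace $S\subset H$ and $A\in L_+(H)$, the set $\{X\in L_+(H): X\leqq A,\ R(X)\subset S\}$ has a maximal (greatest) element with respect to $\leqq$, called the short of $A$ to $S$ and denoted $\mathcal{S}(A)$. For $S=H_1$ (so $S^\perp=H_2$) it is denoted $\mathcal{H}_1(A)$. Compatibility: $A\in L_+(H)$ is compatible with the closed subspace $S^\perp$ if the set $\mathcal{P}(A,S^\perp):=\{Q\in L(H): Q^2=Q,\ R(Q)=S^\perp,\ AQ=Q^*A\}$ of $A$-symmetric oblique projections onto $S^\perp$ is nonempty, where $Q^*$ is the adjoint of $Q$ with respect to the inner product of $H$.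 For a closed subspace $K\subset H$, $P_K$ is the orthogonal projection of $H$ onto $K$. If $H_2$ is finite dimensional, $H_2^n=H_2$ for $n\ge\dim H_2$. *)

(* Defs.v *)
From HB Require Import structures.
From mathcomp Require Import all_boot all_order all_algebra.
From mathcomp Require Import complex sesquilinear.
From mathcomp Require Import all_classical all_reals all_analysis.

Set Implicit Arguments.
Unset Strict Implicit.
Unset Printing Implicit Defensive.

Import Order.TTheory GRing.Theory Num.Theory.
Import numFieldNormedType.Exports.

Local Open Scope classical_set_scope.
Local Open Scope ring_scope.

(* Hilbert spaces are taken over the real or the complex numbers. *)
Variant scalars := RealScalars | ComplexScalars.

Definition scalar_field (R : realType) (k : scalars) : numFieldType :=
  match k with
  | RealScalars => R : numFieldType
  | ComplexScalars => R[i] : numFieldType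
  end.

Definition scalar_conj (R : realType) (k : scalars) :
    scalar_field R k -> scalar_field R k :=
  match k return scalar_field R k -> scalar_field R k with
  | RealScalars => idfun
  | ComplexScalars => Num.conj
  end.

Definition separable (T : topologicalType) : Prop :=
  exists2 D : set T, countable D & dense D.

(* [dot] is linear in its first argument and [theta]-linear in the second one. *)
Section Hilbert.
Context {K : numFieldType} {theta : K -> K} {H : completeNormedModType K}.
Variable dot : {dot H for theta}.

Definition induces_norm : Prop := forall x : H, `|x| ^+ 2 = dot x x.

Definition bounded_operator (T : H -> H) : Prop :=
  linear T /\ exists M : K, forall x, `|T x| <= M * `|x|.

Definition positive_operator (A : H -> H) : Prop :=
  [/\ bounded_operator A,
      forall x y, dot (A x) y = dot x (A y)
    & forall x, 0 <= dot (A x) x].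

Definition le_operator (X A : H -> H) : Prop :=
  positive_operator (fun x => A x - X x).

Definition closed_subspace (S : set H) : Prop :=
  [/\ closed S, S 0 & forall (a : K) x y, S x -> S y -> S (a *: x + y)].

Definition hilbert_split (H1 H2 : set H) : Prop :=
  [/\ closed_subspace H1, closed_subspace H2,
      forall x y, H1 x -> H2 y -> dot x y = 0
    & forall h, exists x y, [/\ H1 x, H2 y & h = x + y]].

(* The orthogonal projection onto a closed subspace [S] maps [x] to the unique
   point [y] of [S] with [x - y] orthogonal to [S]; the default value 0 of
   [xget] is then never used. *)
Definition orthoproj (S : set H) (x : H) : H :=
  xget 0 [set y | S y /\ forall z, S z -> dot (x - y) z = 0].

(* Every bounded operator has a unique adjoint, so the default value of [xget]
   is never used for them. *)
Definition adjoint (Q : H -> H) : H -> H :=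
  xget (fun=> 0) [set Q' | bounded_operator Q' /\
                           forall x y, dot (Q x) y = dot x (Q' y)].

Definition compatible (A : H -> H) (S : set H) : Prop :=
  exists Q : H -> H,
    [/\ bounded_operator Q, Q \o Q = Q, range Q = S & A \o Q = adjoint Q \o A].

Definition short_candidates (A : H -> H) (S : set H) : set (H -> H) :=
  [set X | [/\ positive_operator X, le_operator X A & range X `<=` S]].

(* The greatest element exists and is unique for [A] positive and [S] a closed
   subspace, so the default value of [xget] is then never used. *)
Definition shorted (A : H -> H) (S : set H) : H -> H :=
  xget (fun=> 0) [set X | short_candidates A S X /\
                          forall Y, short_candidates A S Y -> le_operator Y X].

(* The span of those among the first [n] vectors of [e] with index in [I]. *)
Definition span_first (e : nat -> H) (I : set nat) (n : nat) : set H :=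
  [set x | exists c : nat -> K, x = \sum_(i < n | (i : nat) \in I) c i *: e i].

(* Only the [e i] with [I i] are basis vectors: the index set [I] is an initial
   segment of nat, either nat itself or [0, d[ with d = dim S (possibly d = 0). *)
Definition ordered_orthonormal_basis
    (S : set H) (e : nat -> H) (I : set nat) : Prop :=
  [/\ forall i j, (i <= j)%N -> I j -> I i,
      forall i j, I i -> I j -> dot (e i) (e j) = (i == j)%:R
    & closure (\bigcup_n span_first e I n) = S].

Definition wot_cvg (T : nat -> H -> H) (L : H -> H) : Prop :=
  forall h g : H, (fun n => dot (T n h) g) @ \oo --> dot (L h) g.

Definition truncation
    (H1 : set H) (e : nat -> H) (I : set nat) (n : nat) (x : H) : H :=
  orthoproj H1 x + orthoproj (span_first e I n) x.

Definition truncated (A : H -> H)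
    (H1 : set H) (e : nat -> H) (I : set nat) (n : nat) : H -> H :=
  truncation H1 e I n \o A \o truncation H1 e I n.

End Hilbert.

(* Main.v *)
From HB Require Import structures.
Require Import Defs.
From mathcomp Require Import all_boot all_order all_algebra.
From mathcomp Require Import complex sesquilinear.
From mathcomp Require Import all_classical all_reals all_analysis.

(** Write the basis of [H2] as [v 0, v 1, ...], padded by zeros when [H2] is
    finite dimensional. For a positive operator [B] and a vector [v], subtracting
    from [B] the rank one operator [x |-> (<Bx,v> / <Bv,v>) Bv] gives the largest
    positive operator below [B] that kills [v]: the quadratic form at [x] becomes
    the minimum of the form of [B] over the line [x + K v]. Eliminating
    [v 0, ..., v (n - 1)] in turn from [A] produces a positive operator [S n], the
    largest one below [A] that kills these vectors ([schur_max]), and a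
    map [V n], the identity modulo their span, with [S n = A o V n] ([schurE]).

    The operator [S n] answers the finite questions. Let [P1] be the projection
    onto [H1]. The graph map [W n = V n o P1] takes values in the range of the
    truncation [P^n], so [A^n o W n = P1 o S n o P1]. As the right-hand side is
    symmetric, [Q = 1 - W n] is an [A^n]-symmetric projection onto [H2]
    ([truncated_compatible]). A positive operator with range in [H1] has the same
    quadratic form at [h] and at [W n h], which shows that [P1 o S n o P1] is the
    short of [A^n] to [H1] ([shorted_truncated]).

    The sequence [S n] is nonincreasing. For positive [D] with quadratic form
    bounded by [M] one has [|D x|^2 <= M <D x, x>]; applied to the differences
    [S n - S m] this makes [S n x] a Cauchy sequence, so [S n] converges strongly
    to a positive operator [B] ([nonincreasing_cvg_strong]). By density [B] kills
    [H2], hence has range in [H1]; each operator competing for the short of [A]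
    kills every [v i], so lies below every [S n] and therefore below [B]. Hence
    [B] is the short of [A] ([shorted_schur_limit]), and the shorts
    [P1 o S n o P1] of the truncations converge to [P1 o B o P1 = B]. The
    existence of both shorts comes out of the construction. *)

Set Implicit Arguments.
Unset Strict Implicit.
Unset Printing Implicit Defensive.

Import Order.TTheory GRing.Theory Num.Theory.
Import numFieldNormedType.Exports.

Local Open Scope classical_set_scope.
Local Open Scope ring_scope.

(** * Real and complex scalars *)

Section Scalars.
Context {R : realType} {k : scalars}.
Local Notation K := (scalar_field R k).
Local Notation conj := (@scalar_conj R k).

Lemma scalar_conj_is_zmod_morphism : zmod_morphism conj.
Proof. by case: k => //= a b; rewrite rmorphB. Qed.

Lemma scalar_conj_is_monoid_morphism : monoid_morphism conj.
Proof. by case: k => //=; split => [|a b]; rewrite ?rmorph1 ?rmorphM. Qed.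

HB.instance Definition _ :=
  GRing.isZmodMorphism.Build K K conj scalar_conj_is_zmod_morphism.
HB.instance Definition _ :=
  GRing.isMonoidMorphism.Build K K conj scalar_conj_is_monoid_morphism.

Lemma scalar_conj_ge0 (a : K) : 0 <= a -> conj a = a.
Proof. by move: a; case: k => //= a a0; apply: conj_Creal; apply: ger0_real. Qed.

Lemma scalar_mul_conj (a : K) : a * conj a = `|a| ^+ 2.
Proof.
by move: a; case: k => /= a; [rewrite real_normK ?num_real// expr2 | rewrite normCK].
Qed.

Lemma norm_scalar_conj (a : K) : `|conj a| = `|a|.
Proof. by move: a; case: k => //= a; rewrite norm_conjC. Qed.

Lemma real_nonincreasing_cauchy (u : nat -> R) : (forall n, 0 <= u n) ->
  (forall m n, (n <= m)%N -> u m <= u n) ->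
  forall eps : R, 0 < eps ->
  exists N, forall m n, (N <= n)%N -> (n <= m)%N -> u n - u m < eps.
Proof.
move=> u0 umono eps eps0.
have : cvgn u.
  apply: nonincreasing_is_cvgn; first by move=> n m; exact: umono.
  by exists 0 => _ [n _ <-].
move=> /cvg_cauchy/cauchy_ballP/(_ _ eps0)[[A B] /= [[N1 _ HN1] [N2 _ HN2]] H].
exists (maxn N1 N2) => m n; rewrite geq_max => /andP[n1 n2] nm.
have := H (u n, u m); rewrite /ball /= => hh.
apply: le_lt_trans (hh _); first exact: ler_norm.
split; [exact: HN1|exact/HN2/(leq_trans n2)].
Qed.

(** Nonnegative complex numbers are real, so that the real case applies to the
    real parts. *)
Lemma nonincreasing_cauchy (u : nat -> K) : (forall n, 0 <= u n) ->
  (forall m n, (n <= m)%N -> u m <= u n) ->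
  forall eps : K, 0 < eps ->
  exists N, forall m n, (N <= n)%N -> (n <= m)%N -> u n - u m < eps.
Proof.
move: u; case: k => /= u u0 umono eps eps0.
  exact: real_nonincreasing_cauchy.
have uE n : u n = (complex.Re (u n))%:C%C.
  by move: (u0 n); case: (u n) => a b; rewrite lecE /= => /andP[/eqP-> _].
have eE : eps = (complex.Re eps)%:C%C.
  by move: eps0; case: (eps) => a b; rewrite ltcE /= => /andP[/eqP-> _].
have [|||N HN] := @real_nonincreasing_cauchy (fun n => complex.Re (u n)) _ _
    (complex.Re eps).
- by move=> n; have := u0 n; rewrite uE (lecR 0).
- by move=> m n nm; have := umono _ _ nm; rewrite (uE m) (uE n) lecR.
- by rewrite -ltcR -eE.
exists N => m n Nn nm; have := HN m n Nn nm.
by rewrite (uE m) (uE n) eE -rmorphB ltcR.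
Qed.

End Scalars.

(** * Inner products and positive operators *)

Section InnerProduct.
Context {R : realType} {k : scalars}.
Local Notation K := (scalar_field R k).
Local Notation conj := (@scalar_conj R k).
Context {H : completeNormedModType K}.
Variable dot : {dot H for conj}.
Local Notation "''[' x , y ]" := (dot x y).

Implicit Types (x y z : H) (a : K).

Lemma dotC x y : '[x, y] = conj '[y, x].
Proof. by rewrite hermC expr0 mul1r. Qed.

Lemma dot0l y : '[0, y] = 0. Proof. exact: linear0l. Qed.
Lemma dot0r x : '[x, 0] = 0. Proof. exact: linear0r. Qed.
Lemma dotDl x y z : '[x + y, z] = '[x, z] + '[y, z].
Proof. exact: linearDl. Qed.
Lemma dotDr x y z : '[z, x + y] = '[z, x] + '[z, y].
Proof. exact: linearDr. Qed.
Lemma dotBl x y z : '[x - y, z] = '[x, z] - '[y, z].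
Proof. exact: linearBl. Qed.
Lemma dotBr x y z : '[z, x - y] = '[z, x] - '[z, y].
Proof. exact: linearBr. Qed.
Lemma dotZl a x y : '[a *: x, y] = a * '[x, y].
Proof. exact: linearZl_LR. Qed.
Lemma dotZr a x y : '[x, a *: y] = conj a * '[x, y].
Proof. exact: linearZr_LR. Qed.

Lemma dot_eq0C x y : '[x, y] = 0 -> '[y, x] = 0.
Proof. by move=> xy; rewrite dotC xy rmorph0. Qed.

Lemma dot_eq0 x : ('[x, x] == 0) = (x == 0).
Proof.
apply/eqP/eqP => [|->]; last exact: dot0l.
by apply: contra_eq => x0; rewrite gt_eqF// neq0_dnorm_gt0.
Qed.

Lemma dot_inj x y : (forall z, '[x, z] = '[y, z]) -> x = y.
Proof.
by move=> xy; apply/eqP; rewrite -subr_eq0 -dot_eq0 dotBl xy subrr.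
Qed.

Hypothesis dot_norm : induces_norm dot.

Lemma dot_ge0 x : 0 <= '[x, x].
Proof. by rewrite -dot_norm exprn_ge0. Qed.

Lemma cauchy_schwarz x y : `|'[x, y]| <= `|x| * `|y|.
Proof.
have [->|y0] := eqVneq y 0; first by rewrite dot0r normr0 mulr_ge0.
rewrite -(@ler_pXn2r _ 2) ?nnegrE ?mulr_ge0// exprMn !dot_norm.
have yy : 0 < '[y, y] by exact: neq0_dnorm_gt0.
pose z := x - ('[x, y] / '[y, y]) *: y.
have zy : '[z, y] = 0 by rewrite dotBl dotZl divfK ?gt_eqF// subrr.
have : 0 <= '[z, x] * '[y, y].
  rewrite -[x](subrK (('[x, y] / '[y, y]) *: y)) dotDr dotZr zy mulr0 addr0.
  by apply: mulr_ge0; exact: dot_ge0.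
rewrite dotBl dotZl mulrBl mulrAC divfK ?gt_eqF// subr_ge0.
by rewrite (dotC y x) scalar_mul_conj.
Qed.

Lemma linear_apply0 (T : H -> H) : linear T -> T 0 = 0.
Proof.
by move=> TL; rewrite -[X in T X](subrr 0) (zmod_morphism_linear TL) subrr.
Qed.

Lemma linear_applyD (T : H -> H) x y : linear T -> T (x + y) = T x + T y.
Proof. by move=> TL; have := TL 1 x y; rewrite !scale1r. Qed.

(** In the zero space a bound [M] need not be nonnegative, nor even real; there
    every constant is a bound. *)
Lemma bounded_gt0 (T : H -> H) : bounded_operator T ->
  exists2 M : K, 0 < M & forall x, `|T x| <= M * `|x|.
Proof.
move=> [TL [M TM]]; have [[x x0]|H0] := pselect (exists x : H, x != 0).
  have M0 : 0 <= M.
    by rewrite -(@pmulr_lge0 _ `|x|) ?normr_gt0// (le_trans _ (TM x)).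
  exists (M + 1) => [|y]; first by rewrite ltr_wpDl.
  by rewrite (le_trans (TM y))// ler_wpM2r// lerDl.
exists 1 => // x; have -> : x = 0 by apply/eqP/negPn/negP => ?; apply: H0; exists x.
by rewrite linear_apply0// normr0 mulr0.
Qed.

(** Carrying an explicit adjoint along each construction replaces the
    representation theorem for bounded functionals. *)
Definition adjoint_pair (T T' : H -> H) : Prop :=
  [/\ bounded_operator T, bounded_operator T' & forall x y, '[T x, y] = '[x, T' y]].

Lemma bounded_id : bounded_operator (@id H).
Proof. by split=> //; exists 1 => x; rewrite mul1r. Qed.

Lemma bounded_comp (S T : H -> H) :
  bounded_operator S -> bounded_operator T -> bounded_operator (S \o T).
Proof.
move=> /[dup] [[SL _]] /bounded_gt0[M M0 SM] [TL [N TN]]; split.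
  by move=> a x y /=; rewrite TL SL.
by exists (M * N) => x /=; rewrite (le_trans (SM _))// -mulrA ler_wpM2l// ltW.
Qed.

Lemma bounded_sub (S T : H -> H) :
  bounded_operator S -> bounded_operator T -> bounded_operator (fun x => S x - T x).
Proof.
move=> [SL [M SM]] [TL [N TN]]; split.
  by move=> a x y /=; rewrite TL SL scalerBr opprD addrACA.
exists (M + N) => x /=; rewrite (le_trans (ler_normB _ _))// mulrDl.
exact: lerD.
Qed.

Lemma bounded_add (S T : H -> H) :
  bounded_operator S -> bounded_operator T -> bounded_operator (fun x => S x + T x).
Proof.
move=> [SL [M SM]] [TL [N TN]]; split.
  by move=> a x y /=; rewrite TL SL scalerDr addrACA.
exists (M + N) => x /=; rewrite (le_trans (ler_normD _ _))// mulrDl.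
exact: lerD.
Qed.

Lemma bounded_rank1 (u v : H) : bounded_operator (fun x => '[x, u] *: v).
Proof.
split=> [a x y|]; first by rewrite dotDl dotZl scalerDl scalerA.
exists (`|u| * `|v|) => x; rewrite normrZ mulrAC ler_wpM2r//.
by rewrite mulrC cauchy_schwarz.
Qed.

Lemma adjoint_pair_id : adjoint_pair id id.
Proof. by split=> //; exact: bounded_id. Qed.

Lemma adjoint_pair_comp S S' T T' :
  adjoint_pair S S' -> adjoint_pair T T' -> adjoint_pair (S \o T) (T' \o S').
Proof.
move=> [bS bS' SS'] [bT bT' TT']; split; [exact: bounded_comp..|].
by move=> x y /=; rewrite SS' TT'.
Qed.

Lemma adjoint_pair_sub S S' T T' : adjoint_pair S S' -> adjoint_pair T T' ->
  adjoint_pair (fun x => S x - T x) (fun x => S' x - T' x).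
Proof.
move=> [bS bS' SS'] [bT bT' TT']; split; [exact: bounded_sub..|].
by move=> x y /=; rewrite dotBl dotBr SS' TT'.
Qed.

Lemma adjoint_pair_add S S' T T' : adjoint_pair S S' -> adjoint_pair T T' ->
  adjoint_pair (fun x => S x + T x) (fun x => S' x + T' x).
Proof.
move=> [bS bS' SS'] [bT bT' TT']; split; [exact: bounded_add..|].
by move=> x y /=; rewrite dotDl dotDr SS' TT'.
Qed.

Lemma adjoint_pair_rank1 (u v : H) :
  adjoint_pair (fun x => '[x, u] *: v) (fun x => '[x, v] *: u).
Proof.
split; [exact: bounded_rank1..|move=> x y].
by rewrite dotZl dotZr -dotC mulrC.
Qed.

Lemma adjointE Q Q' : adjoint_pair Q Q' -> adjoint dot Q = Q'.
Proof.
move=> [bQ bQ' QQ']; rewrite /adjoint; case: xgetP => [Q'' _ [_ QQ'']|].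
  apply/funext => y; apply: dot_inj => x.
  by rewrite dotC [RHS]dotC -QQ' -QQ''.
by move=> /(_ Q')[]; split.
Qed.

Lemma positive_adjoint_pair A : positive_operator dot A -> adjoint_pair A A.
Proof. by move=> [bA sA _]; split. Qed.

Lemma adjoint_pair_positive A : adjoint_pair A A ->
  (forall x, 0 <= '[A x, x]) -> positive_operator dot A.
Proof. by move=> [bA _ sA] A0; split. Qed.

Lemma positive_conjugate A P P' : positive_operator dot A ->
  adjoint_pair P P' -> positive_operator dot (P' \o A \o P).
Proof.
move=> pA; have [_ _ A0] := pA; move=> PP'; have [_ _ PE] := PP'.
have P'P : adjoint_pair P' P.
  by case: PP' => bP bP' _; split=> // x y; rewrite dotC -PE -dotC.
apply: adjoint_pair_positive.
  exact/(adjoint_pair_comp (adjoint_pair_comp P'P (positive_adjoint_pair pA)) PP').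
by move=> x /=; have [_ _ ->] := P'P.
Qed.

Lemma le_operatorP X A : positive_operator dot X -> positive_operator dot A ->
  le_operator dot X A <-> forall x, '[X x, x] <= '[A x, x].
Proof.
move=> pX pA; split=> [[_ _ XA] x|XA].
  by rewrite -subr_ge0 -dotBl XA.
apply: adjoint_pair_positive => [|x].
  by apply: adjoint_pair_sub; exact: positive_adjoint_pair.
by rewrite dotBl subr_ge0.
Qed.

(** Expand the nonnegative number [<D y, y>] at [y = x - M^-1 D x]. This is the
    operator inequality [D^2 <= M D], obtained without square roots. *)
Lemma positive_sqr_le D (M : K) : positive_operator dot D -> 0 < M ->
  (forall x, '[D x, x] <= M * `|x| ^+ 2) ->
  forall x, `|D x| ^+ 2 <= M * '[D x, x].
Proof.
move=> [[DL _] sD D0] M0 DM x.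
have Mi : 0 <= M^-1 by rewrite invr_ge0 ltW.
have := D0 (x - M^-1 *: D x).
rewrite (zmod_morphism_linear DL) (scalable_linear DL).
rewrite dotBl !dotBr !dotZl !dotZr (scalar_conj_ge0 Mi).
rewrite (sD (D x) x) -dot_norm => h.
have DDx : M^-1 * (M^-1 * '[D (D x), D x]) <= M^-1 * `|D x| ^+ 2.
  by rewrite ler_wpM2l// ler_pdivrMl.
rewrite -ler_pdivrMl// -subr_ge0 (le_trans h)//.
by rewrite gerDl oppr_le0 subr_ge0.
Qed.

Lemma bounded_form A : bounded_operator A ->
  exists2 M : K, 0 < M & forall x, `|'[A x, x]| <= M * `|x| ^+ 2.
Proof.
move=> /bounded_gt0[M M0 AM]; exists M => // x.
by rewrite (le_trans (cauchy_schwarz _ _))// expr2 mulrA ler_wpM2r.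
Qed.

(** The case [<A x, x> = 0] of [positive_sqr_le]. It settles the degenerate
    eliminations: a pivot [<Bv, v>] equal to 0 means that [v] is already killed. *)
Lemma positive_ker A x : positive_operator dot A -> '[A x, x] = 0 -> A x = 0.
Proof.
move=> pA Ax0; have [bA sA A0] := pA; have [M M0 AM] := bounded_form bA.
have {}AM y : '[A y, y] <= M * `|y| ^+ 2 by rewrite -(ger0_norm (A0 y)).
have := positive_sqr_le pA M0 AM x; rewrite Ax0 mulr0 => h.
by apply/eqP; rewrite -normr_eq0 -sqrf_eq0 eq_le h exprn_ge0.
Qed.

Lemma le_operator_anti X Y : le_operator dot X Y -> le_operator dot Y X -> X = Y.
Proof.
move=> XY YX; apply/funext => x; apply/eqP; rewrite eq_sym -subr_eq0.
apply/eqP; apply: (positive_ker XY); apply/le_anti.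
have [_ _ ->] := XY; have [_ _ /(_ x)] := YX.
by rewrite -opprB linearNl oppr_ge0 => ->.
Qed.

(** The order on operators is antisymmetric, so that exhibiting one greatest
    candidate determines the short. *)
Lemma shortedE A S X : short_candidates dot A S X ->
  (forall Y, short_candidates dot A S Y -> le_operator dot Y X) ->
  shorted dot A S = X.
Proof.
move=> cX maxX; rewrite /shorted; case: xgetP => [Y _ [cY maxY]|].
  by apply: le_operator_anti; [exact: maxX|exact: maxY].
by move=> /(_ X)[]; split.
Qed.

End InnerProduct.

(** * Schur complements by successive elimination *)

Section SchurComplement.
Context {R : realType} {k : scalars}.
Local Notation K := (scalar_field R k).
Local Notation conj := (@scalar_conj R k).
Context {H : completeNormedModType K}.
Variable dot : {dot H for conj}.
Local Notation "''[' x , y ]" := (dot x y).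
Hypothesis dot_norm : induces_norm dot.
Implicit Types (v x y : H) (B X : H -> H).

(** The minimizer of the form of [B] on the line [x + K v]. When [<Bv, v> = 0] the
    quotient is 0 and [pivot B v] is the identity; as then [Bv = 0], this is still
    a minimizer. *)
Definition pivot B v x : H := x - ('[B x, v] / '[B v, v]) *: v.

(** The Schur complement of [B] with respect to the line spanned by [v]. *)
Definition eliminate B v : H -> H := B \o pivot B v.

Lemma adjoint_pair_pivot B v : positive_operator dot B ->
  adjoint_pair dot (pivot B v) (fun y => y - '[y, '[B v, v]^-1 *: v] *: B v).
Proof.
move=> [_ sB _].
have -> : pivot B v = fun x => x - '[x, B v] *: ('[B v, v]^-1 *: v).
  by apply/funext => x; rewrite /pivot sB scalerA.
apply: adjoint_pair_sub; first exact: adjoint_pair_id.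
exact: adjoint_pair_rank1.
Qed.

(** The first-order condition for the minimum over [x + K v]. *)
Lemma dot_eliminate B v x : positive_operator dot B -> '[eliminate B v x, v] = 0.
Proof.
move=> pB; have [[BL _] sB _] := pB; rewrite /eliminate /pivot /=.
have [Bv0|Bv0] := eqVneq '[B v, v] 0.
  by rewrite sB (positive_ker dot_norm pB Bv0) dot0r.
rewrite (zmod_morphism_linear BL) (scalable_linear BL) dotBl dotZl.
by rewrite divfK// subrr.
Qed.

Lemma eliminate_self B v : positive_operator dot B -> eliminate B v v = 0.
Proof.
move=> pB; have [[BL _] sB _] := pB; rewrite /eliminate /pivot /=.
have [Bv0|Bv0] := eqVneq '[B v, v] 0.
  by rewrite Bv0 mul0r scale0r subr0 (positive_ker dot_norm pB Bv0).
by rewrite divff// scale1r subrr (linear_apply0 BL).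
Qed.

Lemma eliminate_ker B v x : B x = 0 -> eliminate B v x = 0.
Proof.
by move=> Bx; rewrite /eliminate /pivot /= Bx dot0l mul0r scale0r subr0.
Qed.

Lemma dot_eliminate_pivot B v x y : positive_operator dot B ->
  '[eliminate B v x, y] = '[B (pivot B v x), pivot B v y].
Proof. by move=> pB; rewrite dotBr dotZr dot_eliminate// mulr0 subr0. Qed.

Lemma eliminate_positive B v :
  positive_operator dot B -> positive_operator dot (eliminate B v).
Proof.
move=> pB; have [bB sB B0] := pB; split.
- by apply: bounded_comp => //; have [] := adjoint_pair_pivot v pB.
- move=> x y; rewrite dot_eliminate_pivot// sB.
  by rewrite dotC -dot_eliminate_pivot// -dotC.
- by move=> x; rewrite dot_eliminate_pivot.
Qed.

Lemma eliminate_le B v x :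
  positive_operator dot B -> '[eliminate B v x, x] <= '[B x, x].
Proof.
move=> pB; have [[BL _] sB B0] := pB; rewrite /eliminate /pivot /=.
rewrite (zmod_morphism_linear BL) (scalable_linear BL) dotBl dotZl.
rewrite gerBl mulrAC (sB v x) (dotC _ v) scalar_mul_conj.
by rewrite mulr_ge0 ?invr_ge0 ?exprn_ge0.
Qed.

(** An operator [X] that kills [v] has the same form at [x] and at
    [pivot B v x], where the form of [B] is that of [eliminate B v] at [x]. *)
Lemma eliminate_max B v X : positive_operator dot B -> positive_operator dot X ->
  (forall x, '[X x, x] <= '[B x, x]) -> X v = 0 ->
  forall x, '[X x, x] <= '[eliminate B v x, x].
Proof.
move=> pB [[XL _] sX _] XB Xv x; rewrite dot_eliminate_pivot//.
have Xp : X (pivot B v x) = X x.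
  rewrite /pivot (zmod_morphism_linear XL) (scalable_linear XL) Xv.
  by rewrite /= scaler0 subr0.
by rewrite (_ : '[X x, x] = '[X (pivot B v x), pivot B v x]) ?XB// Xp !sX Xp.
Qed.

Variables (A : H -> H) (v : nat -> H).

Fixpoint schur n : H -> H :=
  if n is m.+1 then eliminate (schur m) (v m) else A.

(** The accumulated changes of variable, which give [schur n = A \o elim_map n]. *)
Fixpoint elim_map n : H -> H :=
  if n is m.+1 then elim_map m \o pivot (schur m) (v m) else id.

Lemma schurE n : schur n = A \o elim_map n.
Proof. by elim: n => //= n IHn; rewrite /eliminate {1}IHn. Qed.

Hypothesis posA : positive_operator dot A.

Lemma schur_positive n : positive_operator dot (schur n).
Proof. by elim: n => //= n; exact: eliminate_positive. Qed.

Lemma schur_nonincreasing m n x :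
  (n <= m)%N -> '[schur m x, x] <= '[schur n x, x].
Proof.
move=> /subnK <-; elim: (m - n)%N => //= d; apply: le_trans.
exact/eliminate_le/schur_positive.
Qed.

(** Eliminating a vector does not revive the vectors that were killed before. *)
Lemma schur_ker n i : (i < n)%N -> schur n (v i) = 0.
Proof.
elim: n => //= n IHn; rewrite ltnS leq_eqVlt => /predU1P[->|/IHn].
  exact/eliminate_self/schur_positive.
exact: eliminate_ker.
Qed.

Lemma schur_max X n : positive_operator dot X ->
  (forall x, '[X x, x] <= '[A x, x]) -> (forall i, (i < n)%N -> X (v i) = 0) ->
  forall x, '[X x, x] <= '[schur n x, x].
Proof.
move=> pX XA; elim: n => //= n IHn Xv; apply: eliminate_max => //.
- exact: schur_positive.
- by apply: IHn => i /ltnW; exact: Xv.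
- exact: Xv.
Qed.

Lemma adjoint_pair_elim_map n : exists V', adjoint_pair dot (elim_map n) V'.
Proof.
elim: n => /= [|n [V' VV']]; first by exists id; exact: adjoint_pair_id.
eexists; apply: adjoint_pair_comp VV' _.
exact/adjoint_pair_pivot/schur_positive.
Qed.

(** Each pivot moves its argument by a multiple of the eliminated vector. *)
Lemma elim_map_sub (S : set H) n : S 0 ->
  (forall (a : K) x y, S x -> S y -> S (a *: x + y)) ->
  (forall i, (i < n)%N -> S (v i)) -> forall x, S (elim_map n x - x).
Proof.
move=> S0 SD; elim: n => /= [_ x|n IHn Sv x]; first by rewrite subrr.
set p := pivot (schur n) (v n) x.
have -> : elim_map n p - x =
    - ('[schur n x, v n] / '[schur n (v n), v n]) *: v n + (elim_map n p - p).
  by rewrite scaleNr {2}/p /pivot opprB (addrCA (elim_map n p)) addKr.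
apply: SD; first exact: Sv.
by apply: IHn => i /ltnW; exact: Sv.
Qed.

End SchurComplement.

(** * Monotone limits of positive operators *)

Section Limits.

(** In a partially ordered field the nonnegative elements are those equal to
    their norm, and [`|a| - a] is at most twice the distance from [a] to a
    nonnegative element. *)
Lemma cvg_ge0 (K : numFieldType) (u : nat -> K) (a : K) :
  u @ \oo --> a -> (forall n, 0 <= u n) -> 0 <= a.
Proof.
move=> ua u0; have [->|/eqP aN] := eqVneq a `|a|; first exact: normr_ge0.
pose e := `| `|a| - a | / 2.
have e0 : 0 < e.
  by rewrite divr_gt0// normr_gt0 subr_eq0 eq_sym; apply/eqP.
have /cvgrPdist_lt/(_ _ e0)[N _ /(_ N (leqnn N))/= aN_lt] := ua.
have : `| `|a| - a | < `| `|a| - a |.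
  rewrite [ltRHS]splitr -/e.
  apply: (le_lt_trans _ (ltrD aN_lt aN_lt)).
  rewrite -(subrKA (u N)) (le_trans (ler_normD _ _))// lerD//.
    by rewrite -{1}(ger0_norm (u0 N)) ler_dist_dist.
  by rewrite distrC.
by rewrite ltxx.
Qed.

Lemma cvg_le (K : numFieldType) (u w : nat -> K) (a b : K) :
  u @ \oo --> a -> w @ \oo --> b -> (forall n, u n <= w n) -> a <= b.
Proof.
move=> ua wb uw; rewrite -subr_ge0; apply: cvg_ge0 (cvgB wb ua) _ => n.
by rewrite subr_ge0.
Qed.

Context {R : realType} {k : scalars}.
Local Notation K := (scalar_field R k).
Local Notation conj := (@scalar_conj R k).
Context {H : completeNormedModType K}.
Variable dot : {dot H for conj}.
Local Notation "''[' x , y ]" := (dot x y).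
Hypothesis dot_norm : induces_norm dot.
Implicit Types (x y : H).

Lemma cvg_dotl (u : nat -> H) x y :
  u @ \oo --> x -> (fun n => '[u n, y]) @ \oo --> '[x, y].
Proof.
move=> /cvgrPdist_lt ux; apply/cvgrPdist_lt => e e0.
have y1 : 0 < `|y| + 1 by rewrite ltr_wpDl.
have := ux _ (divr_gt0 e0 y1); apply: filterS => n /=.
rewrite ltr_pdivlMr// -dotBl => h; apply: le_lt_trans h.
rewrite (le_trans (cauchy_schwarz dot_norm _ _))// ler_wpM2l//.
by rewrite lerDl.
Qed.

Lemma cvg_dotr (u : nat -> H) x y :
  u @ \oo --> x -> (fun n => '[y, u n]) @ \oo --> '[y, x].
Proof.
move=> /(@cvg_dotl _ _ y)/cvgrPdist_lt ux; apply/cvgrPdist_lt => e e0.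
have := ux _ e0; apply: filterS => n /=.
by rewrite (dotC _ y) (dotC _ y (u n)) -rmorphB norm_scalar_conj.
Qed.

Variable T : nat -> H -> H.
Hypothesis T_positive : forall n, positive_operator dot (T n).
Hypothesis T_nonincreasing :
  forall m n x, (n <= m)%N -> '[T m x, x] <= '[T n x, x].

(** For [n <= m] the difference [T n - T m] is positive with form at most that of
    [T 0], so that [|T n x - T m x|^2] is controlled by the decrease of the
    convergent scalar sequence [<T n x, x>]. *)
Lemma nonincreasing_cvg_strong : exists B, [/\ positive_operator dot B,
  forall x, (fun n => T n x) @ \oo --> B x &
  forall n x, '[B x, x] <= '[T n x, x]].
Proof.
have [bT0 _ _] := T_positive 0; have [M M0 T0M] := bounded_form dot_norm bT0.
have TM n x : '[T n x, x] <= M * `|x| ^+ 2.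
  apply: le_trans (T0M x); apply: le_trans (T_nonincreasing _ (leq0n n)) _.
  by have [_ _ T0] := T_positive 0; rewrite ger0_norm.
have Tbound n x : `|T n x| <= M * `|x|.
  rewrite -(@ler_pXn2r _ 2) ?nnegrE ?mulr_ge0 ?(ltW M0)//.
  rewrite (le_trans (positive_sqr_le dot_norm (T_positive n) M0 (TM n) x))//.
  by rewrite exprMn expr2 -mulrA ler_wpM2l// ltW.
have Tdist m n x : (n <= m)%N ->
    `|T n x - T m x| ^+ 2 <= M * ('[T n x, x] - '[T m x, x]).
  move=> nm; rewrite -dotBl.
  have pD : le_operator dot (T m) (T n).
    by apply/le_operatorP => // y; exact: T_nonincreasing.
  apply: (positive_sqr_le dot_norm pD M0) => y; rewrite dotBl.
  by rewrite (le_trans _ (TM n y))// gerBl; have [] := T_positive m.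
have Tcvg x : cvg ((fun n => T n x) @ \oo).
  apply/cauchy_cvgP/cauchy_exP => e e0.
  have e2 : 0 < e ^+ 2 / M by rewrite divr_gt0// exprn_gt0.
  have [||N HN] := @nonincreasing_cauchy R k (fun n => '[T n x, x]) _ _ _ e2.
  - by move=> n; have [] := T_positive n.
  - by move=> m n; exact: T_nonincreasing.
  exists (T N x), N => // m /= Nm; rewrite -ball_normE /=.
  rewrite -(@ltr_pXn2r _ 2) ?nnegrE ?(ltW e0)//.
  apply: le_lt_trans (Tdist _ _ _ Nm) _.
  by rewrite mulrC -ltr_pdivlMr// HN.
pose B x : H := lim ((fun n => T n x) @ \oo).
have TB x : (fun n => T n x) @ \oo --> B x by exact: Tcvg.
exists B; split=> //.
  split.
  - split.
      move=> a x y; have [[L _] _ _] := T_positive 0.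
      apply/cvg_lim => //=.
      have -> : (fun n => T n (a *: x + y)) = (fun n => a *: T n x + T n y).
        by apply/funext => n; have [[TL _] _ _] := T_positive n; exact: TL.
      by apply: cvgD => //; apply: cvgZr.
    exists M => x; exact: cvg_le (cvg_norm (TB x)) (cvg_cst _) _.
  - move=> x y; apply: cvg_unique (cvg_dotl (y := y) (TB x)) _ => //.
    have -> : (fun n => '[T n x, y]) = (fun n => '[x, T n y]).
      by apply/funext => n; have [] := T_positive n.
    exact: cvg_dotr.
  - by move=> x; apply: cvg_ge0 (cvg_dotl (TB x)) _ => n; have [] := T_positive n.
move=> n x.
rewrite -subr_ge0.
apply: (@cvg_ge0 _ (fun m => '[T n x, x] - '[T (m + n)%N x, x])).
  apply: cvgB; first exact: cvg_cst.
  by rewrite (cvg_shiftn n (fun m => '[T m x, x])); exact: cvg_dotl.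
by move=> m; rewrite subr_ge0 T_nonincreasing// leq_addl.
Qed.

End Limits.

(** * Orthogonal projections *)

Section Projections.
Context {R : realType} {k : scalars}.
Local Notation K := (scalar_field R k).
Local Notation conj := (@scalar_conj R k).
Context {H : completeNormedModType K}.
Variable dot : {dot H for conj}.
Local Notation "''[' x , y ]" := (dot x y).
Hypothesis dot_norm : induces_norm dot.
Implicit Types (x y z h : H) (S : set H).

Definition linear_subspace S : Prop :=
  S 0 /\ forall (a : K) x y, S x -> S y -> S (a *: x + y).

Lemma subspaceB S x y : linear_subspace S -> S x -> S y -> S (x - y).
Proof. by move=> [_ SL] Sx Sy; rewrite addrC -scaleN1r; exact: SL. Qed.

Lemma orthoprojE S h y : linear_subspace S -> S y ->
  (forall z, S z -> '[h - y, z] = 0) -> orthoproj dot S h = y.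
Proof.
move=> SL Sy hy; rewrite /orthoproj; case: xgetP => [y' _ [Sy' hy']|].
  pose d := y' - y; have Sd : S d by exact: subspaceB.
  have dE : d = (h - y) - (h - y') by rewrite opprB [RHS]addrC subrKA.
  apply/eqP; rewrite -subr_eq0 -(dot_eq0 dot) -/d {1}dE dotBl.
  by rewrite hy// hy'// subrr.
by move=> /(_ y)[]; split.
Qed.

(** The two kinds of subspaces that matter, a summand of an orthogonal split and
    the span of finitely many orthonormal vectors, have this property for
    algebraic reasons. *)
Definition projectable S : Prop :=
  linear_subspace S /\
  forall h, exists y, S y /\ forall z, S z -> '[h - y, z] = 0.

Section OrthogonalProjection.
Variable S : set H.
Hypothesis projS : projectable S.
Local Notation P := (orthoproj dot S).

Lemma orthoproj_in h : S (P h).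
Proof.
have [SL /(_ h)[y [Sy hy]]] := projS.
by rewrite (orthoprojE SL Sy).
Qed.

Lemma orthoproj_perp h z : S z -> '[h - P h, z] = 0.
Proof.
have [SL /(_ h)[y [Sy hy]]] := projS.
by rewrite (orthoprojE SL Sy)//; exact: hy.
Qed.

Lemma orthoproj_dot h z : S z -> '[P h, z] = '[h, z].
Proof.
by move=> Sz; apply/eqP; rewrite eq_sym -subr_eq0 -dotBl orthoproj_perp.
Qed.

Lemma orthoproj_id h : S h -> P h = h.
Proof.
move=> Sh; apply: orthoprojE => //; first by have [] := projS.
by move=> z _; rewrite subrr dot0l.
Qed.

Lemma orthoproj_eq0 h : (forall z, S z -> '[h, z] = 0) -> P h = 0.
Proof.
move=> hS; have [SL _] := projS; apply: orthoprojE => //.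
  by have [] := SL.
by move=> z Sz; rewrite subr0 hS.
Qed.

Lemma adjoint_pair_orthoproj : adjoint_pair dot P P.
Proof.
have [SL _] := projS.
have bP : bounded_operator P.
  split.
    move=> a x y; apply: orthoprojE => // [|z Sz].
      by have [_] := SL; apply; exact: orthoproj_in.
    rewrite opprD addrACA -scalerBr dotDl dotZl.
    by rewrite !orthoproj_perp// mulr0 addr0.
  exists 1 => x; rewrite mul1r.
  have [->|P0] := eqVneq (P x) 0; first by rewrite normr0.
  rewrite -(@ler_pM2r _ `|P x|) ?normr_gt0// -expr2 dot_norm.
  rewrite orthoproj_dot; last exact: orthoproj_in.
  rewrite (le_trans _ (cauchy_schwarz dot_norm _ _))//.
  rewrite -(orthoproj_dot _ (orthoproj_in x)) ger0_norm//.
  exact: dot_ge0.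
split=> // x y.
rewrite -[in LHS](subrK (P y) y) dotDr (dotC _ (P x)).
rewrite orthoproj_perp ?rmorph0 ?add0r; last exact: orthoproj_in.
by rewrite orthoproj_dot//; exact: orthoproj_in.
Qed.

End OrthogonalProjection.

Lemma split_projectable H1 H2 : hilbert_split dot H1 H2 -> projectable H1.
Proof.
move=> [[_ H10 H1L] _ perp split]; split=> // h.
have [x [y [H1x H2y ->]]] := split h; exists x; split=> // z H1z.
by rewrite addrC addKr dotC perp// rmorph0.
Qed.

Lemma split_orthogonal H1 H2 h : hilbert_split dot H1 H2 ->
  (forall y, H2 y -> '[h, y] = 0) -> H1 h.
Proof.
move=> [_ _ perp split] hH2; have [x [y [H1x H2y hE]]] := split h.
suff y0 : y = 0 by rewrite hE y0 addr0.
apply/eqP; rewrite -(dot_eq0 dot); apply/eqP.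
by have := hH2 y H2y; rewrite hE dotDl (perp _ _ H1x H2y) add0r.
Qed.

Lemma split_complement H1 H2 h : hilbert_split dot H1 H2 ->
  H2 (h - orthoproj dot H1 h).
Proof.
move=> sH; have [[_ H10 H1L] _ perp split] := sH.
have [x [y [H1x H2y ->]]] := split h.
rewrite (@orthoprojE H1 _ x)//; first by rewrite addrC addKr.
by move=> z H1z; rewrite addrC addKr dotC perp// rmorph0.
Qed.

Section Span.
Variables (e : nat -> H) (I : set nat).
Local Notation span := (span_first e I).

(** Padding by zeros makes the sequence total: eliminating the zero vector changes
    nothing, and it adds nothing to a span. *)
Definition basis_vector i : H := if i \in I then e i else 0.

Lemma span_firstE n :
  span n = [set x | exists c : nat -> K, x = \sum_(i < n) c i *: basis_vector i].
Proof.
have sumE (c : nat -> K) : \sum_(i < n | (i : nat) \in I) c i *: e i =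
    \sum_(i < n) c i *: basis_vector i.
  rewrite big_mkcond; apply: eq_bigr => i _.
  by rewrite /basis_vector; case: ifP; rewrite ?scaler0.
by apply/seteqP; split=> x /= [c ->]; exists c; rewrite sumE.
Qed.

Lemma span_subspace n : linear_subspace (span n).
Proof.
rewrite span_firstE; split=> [|a x y [c ->] [d ->]].
  by exists (fun=> 0); rewrite big1// => i _; rewrite scale0r.
exists (fun i => a * c i + d i); rewrite scaler_sumr -big_split /=.
by apply: eq_bigr => i _; rewrite scalerDl scalerA.
Qed.

Lemma basis_vector_span n i : (i < n)%N -> span n (basis_vector i).
Proof.
move=> ilt; rewrite span_firstE; exists (fun j => (j == i)%:R).
rewrite (bigD1 (Ordinal ilt))//= eqxx scale1r big1 ?addr0// => j /negPf.
by rewrite -val_eqE /= => ->; rewrite scale0r.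
Qed.

Lemma span_perp n h : (forall i, (i < n)%N -> '[h, basis_vector i] = 0) ->
  forall z, span n z -> '[h, z] = 0.
Proof.
move=> hv z; rewrite span_firstE => -[c ->].
apply: (big_ind (fun y => '[h, y] = 0)) => [|x y hx hy|i _].
- exact: dot0r.
- by rewrite dotDr hx hy addr0.
- by rewrite dotZr hv// mulr0.
Qed.

Hypothesis orthonormal_e :
  forall i j, I i -> I j -> '[e i, e j] = (i == j)%:R.

Lemma span_projectable n : projectable (span n).
Proof.
split=> [|h]; first exact: span_subspace.
exists (\sum_(i < n) '[h, basis_vector i] *: basis_vector i); split.
  by rewrite span_firstE; exists (fun i => '[h, basis_vector i]).
apply: span_perp => j jn; rewrite dotBl.
have -> : '[\sum_(i < n) '[h, basis_vector i] *: basis_vector i, basis_vector j]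
    = \sum_(i < n) '[h, basis_vector i] * '[basis_vector i, basis_vector j].
  apply: (big_ind2 (fun x a => '[x, basis_vector j] = a)) => //.
  - exact: dot0l.
  - by move=> x _ y _ <- <-; rewrite dotDl.
  - by move=> i _; rewrite dotZl.
rewrite (bigD1 (Ordinal jn))//= big1 ?addr0 => [|i /negPf].
  rewrite /basis_vector; case: ifPn => [|_]; last by rewrite !dot0r mul0r subrr.
  by rewrite inE => Ij; rewrite orthonormal_e// eqxx mulr1 subrr.
rewrite -val_eqE /= => ij; rewrite /basis_vector.
case: ifPn => [|_]; last by rewrite dot0l mulr0.
rewrite inE => Ii; case: ifPn => [|_]; last by rewrite dot0r mulr0.
by rewrite inE => Ij; rewrite orthonormal_e// ij mulr0.
Qed.

End Span.

End Projections.

(** * Shorts of the truncated operators *)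

Section ShortedTruncations.
Context {R : realType} {k : scalars}.
Local Notation K := (scalar_field R k).
Local Notation conj := (@scalar_conj R k).
Context {H : completeNormedModType K}.
Variable dot : {dot H for conj}.
Local Notation "''[' x , y ]" := (dot x y).
Hypothesis dot_norm : induces_norm dot.
Variables (A : H -> H) (H1 H2 : set H) (e : nat -> H) (I : set nat).
Hypothesis posA : positive_operator dot A.
Hypothesis splitH : hilbert_split dot H1 H2.
Hypothesis basis_e : ordered_orthonormal_basis dot H2 e I.
Implicit Types (x y z h : H).

Local Notation v := (basis_vector e I).
Local Notation span := (span_first e I).
Local Notation P1 := (orthoproj dot H1).

Let proj1 : projectable dot H1 := split_projectable splitH.

Let projspan n : projectable dot (span n).
Proof. by apply: span_projectable; have [] := basis_e. Qed.

Lemma span_sub n : span n `<=` H2.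
Proof.
have [_ _ <-] := basis_e; apply: subset_trans (@subset_closure _ _).
exact: bigcup_sup.
Qed.

Lemma basis_vector_in i : H2 (v i).
Proof. by apply: (@span_sub i.+1); exact: basis_vector_span. Qed.

(** The span of the basis is dense in [H2], and [H1] is all of the orthogonal
    complement of [H2]. *)
Lemma basis_perp h : (forall i, '[h, v i] = 0) -> H1 h.
Proof.
move=> hv; apply: split_orthogonal splitH _ => y.
have [_ _ <-] := basis_e => yc.
have hspan n z : span n z -> '[z, h] = 0.
  by move=> sz; apply: (dot_eq0C (x := h)); apply: span_perp sz => i _; exact: hv.
apply: dot_eq0C; apply: contrapT => /eqP yh.
have e0 : 0 < `|'[y, h]| / (`|h| + 1) by rewrite divr_gt0 ?normr_gt0 ?ltr_wpDl.
have [z [[n _ sz]]] := yc _ (nbhsx_ballx y _ e0).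
rewrite -ball_normE /= ltr_pdivlMr ?ltr_wpDl// => /lt_geF/negP; apply.
have -> : '[y, h] = '[y - z, h] by rewrite dotBl (hspan n z sz) subr0.
rewrite (le_trans (cauchy_schwarz dot_norm _ _))//.
by rewrite ler_wpM2l// lerDl.
Qed.

Lemma orthoproj_eq0_H2 y : H2 y -> P1 y = 0.
Proof.
have [_ _ perp _] := splitH => H2y.
by apply: orthoproj_eq0 => // z H1z; apply: dot_eq0C; exact: perp.
Qed.

(** The kernel of a symmetric operator is orthogonal to its range. *)
Lemma positive_range_ker X y : positive_operator dot X -> range X `<=` H1 ->
  H2 y -> X y = 0.
Proof.
move=> [_ sX _] XH1 H2y; apply: (dot_inj (dot := dot)) => z; rewrite sX dot0l.
by have [_ _ perp _] := splitH; apply/dot_eq0C/perp => //; apply: XH1; exists z.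
Qed.

(** Being below [schur i.+1], which kills [v i], forces [B] to kill [v i] too. *)
Lemma schur_limit_candidate B : positive_operator dot B ->
  (forall n x, '[B x, x] <= '[schur dot A v n x, x]) ->
  short_candidates dot A H1 B.
Proof.
move=> pB BS; have [_ sB B0] := pB; split=> //.
  by apply/le_operatorP => // x; exact: (BS 0).
move=> _ [x _ <-]; apply: basis_perp => i.
have Bv : B (v i) = 0.
  apply: positive_ker => //; apply/le_anti.
  by rewrite B0 andbT (le_trans (BS i.+1 _))// schur_ker// dot0l.
by rewrite sB Bv dot0r.
Qed.

(** A competitor has range in [H1], so it kills every [v i] and lies below every
    [schur n]; the inequality of forms passes to the limit. *)
Lemma shorted_schur_limit B : positive_operator dot B ->
  (forall x, (fun n => schur dot A v n x) @ \oo --> B x) ->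
  (forall n x, '[B x, x] <= '[schur dot A v n x, x]) ->
  shorted dot A H1 = B.
Proof.
move=> pB SB BS; apply: shortedE => //; first exact: schur_limit_candidate.
move=> X [pX XA XH1]; apply/le_operatorP => // x.
apply: cvg_le (cvg_cst _) (cvg_dotl dot_norm (y := x) (SB x)) _ => n.
apply: schur_max => // [|i _]; first exact/(le_operatorP pX posA).
exact: positive_range_ker pX XH1 (basis_vector_in i).
Qed.

Section Truncation.
Variable n : nat.
Local Notation Ps := (orthoproj dot (span n)).
Local Notation Pn := (truncation dot H1 e I n).
Local Notation An := (truncated dot A H1 e I n).
Local Notation S := (schur dot A v n).
Local Notation V := (elim_map dot A v n).

Lemma adjoint_pair_truncation : adjoint_pair dot Pn Pn.
Proof.
by apply: adjoint_pair_add; exact: adjoint_pair_orthoproj.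
Qed.

Lemma truncated_positive : positive_operator dot An.
Proof. exact: positive_conjugate posA adjoint_pair_truncation. Qed.

Lemma truncation_id x z : H1 x -> span n z -> Pn (x + z) = x + z.
Proof.
move=> H1x sz; have [_ _ perp _] := splitH.
have [[P1L _] _ _] := adjoint_pair_orthoproj dot_norm proj1.
have [[PsL _] _ _] := adjoint_pair_orthoproj dot_norm (projspan n).
rewrite /truncation (linear_applyD _ _ P1L) (linear_applyD _ _ PsL) orthoproj_id//.
rewrite (orthoproj_eq0_H2 (span_sub sz)) addr0.
rewrite (orthoproj_eq0 (projspan n) (h := x)).
  by rewrite orthoproj_id// add0r.
by move=> y /span_sub; exact: perp.
Qed.

Lemma schur_span_ker z : span n z -> S z = 0.
Proof.
move=> sz; have [_ sS _] := schur_positive dot_norm v posA n.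
apply: (dot_inj (dot := dot)) => y; rewrite dot0l sS; apply: dot_eq0C.
apply: span_perp sz => i ilt; rewrite sS.
by rewrite schur_ker// dot0r.
Qed.

(** [W h] minimizes the form of [A] on [P1 h + span n]; the set of its values is the
    graph over [H1] of the map [W - P1] from [H1] to [H2]. *)
Definition graph_map h := V (P1 h).
Local Notation W := graph_map.

Lemma graph_map_sub h : span n (W h - P1 h).
Proof.
have [s0 sL] := span_subspace e I n.
by apply: elim_map_sub => // i; exact: basis_vector_span.
Qed.

Lemma orthoproj_graph_map h : P1 (W h) = P1 h.
Proof.
have [[P1L _] _ _] := adjoint_pair_orthoproj dot_norm proj1.
rewrite -(subrK (P1 h) (W h)) (linear_applyD _ _ P1L).
rewrite (orthoproj_eq0_H2 (span_sub (graph_map_sub h))) add0r.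
by rewrite orthoproj_id//; exact: orthoproj_in.
Qed.

Lemma graph_map_complement h : H2 (h - W h).
Proof.
have [_ [_ H20 H2L] _ _] := splitH.
rewrite -(subrKA (P1 h)) -[P1 h - W h]opprB.
apply: (@subspaceB _ _ _ H2); first by split.
  exact: split_complement splitH.
exact/span_sub/graph_map_sub.
Qed.

Definition short_truncated : H -> H := P1 \o S \o P1.
Local Notation T := short_truncated.

(** The truncation fixes [W h], where [A] takes the value [S (P1 h)]; this value is
    orthogonal to the span, so truncating it again amounts to applying [P1]. *)
Lemma truncated_graph_map h : An (W h) = T h.
Proof.
have P1h : H1 (P1 h) by exact: orthoproj_in.
rewrite /truncated /=.
have -> : Pn (W h) = W h.
  by rewrite -(subrK (P1 h) (W h)) addrC truncation_id//; exact: graph_map_sub.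
have -> : A (W h) = S (P1 h) by rewrite schurE.
rewrite /short_truncated /truncation /=.
rewrite (orthoproj_eq0 (projspan n)) ?addr0// => z sz.
have [_ sS _] := schur_positive dot_norm v posA n.
by rewrite sS schur_span_ker// dot0r.
Qed.

Lemma short_truncated_positive : positive_operator dot T.
Proof.
apply: positive_conjugate; first exact: schur_positive.
exact: adjoint_pair_orthoproj.
Qed.

Lemma dot_short_truncated x y : '[T x, y] = '[S (P1 x), P1 y].
Proof. by have [_ _ PE] := adjoint_pair_orthoproj dot_norm proj1; exact: PE. Qed.

Lemma dot_schur_truncation h : '[S (Pn h), Pn h] = '[S (P1 h), P1 h].
Proof.
have [[SL _] sS _] := schur_positive dot_norm v posA n.
have SPs : S (Ps h) = 0 by exact/schur_span_ker/(orthoproj_in (projspan n)).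
rewrite /truncation (linear_applyD _ _ SL) SPs addr0.
by rewrite dotDr [X in _ + X]sS SPs dot0r addr0.
Qed.

(** A competitor [X] kills [h - W h], hence has the same form at [h] and at [W h],
    where the form of [An] equals that of [T] at [h]. *)
Lemma shorted_truncated : shorted dot An H1 = T.
Proof.
have pT := short_truncated_positive; have pAn := truncated_positive.
apply: (shortedE dot_norm).
  split=> //; last by move=> _ [x _ <-]; exact: orthoproj_in.
  apply/le_operatorP => // h; rewrite dot_short_truncated -dot_schur_truncation.
  have [_ _ PE] := adjoint_pair_truncation.
  rewrite /truncated /= PE.
  exact: (schur_nonincreasing dot_norm v posA _ (leq0n n)).
move=> X [pX XA XH1]; apply/le_operatorP => // h.
have [[XL _] sX _] := pX.
have XW : X h = X (W h).
  apply/eqP; rewrite -subr_eq0 -(zmod_morphism_linear XL).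
  by rewrite (positive_range_ker pX XH1 (graph_map_complement h)).
have -> : '[X h, h] = '[X (W h), W h] by rewrite -[in RHS]XW !sX -XW.
have -> : '[T h, h] = '[An (W h), W h].
  by rewrite truncated_graph_map !dot_short_truncated orthoproj_graph_map.
by move: (W h); exact/(le_operatorP pX pAn).
Qed.

(** The projection is [h |-> h - W h]. It is [An]-symmetric because [An] composed
    with it is [An - T], a difference of symmetric operators. *)
Lemma truncated_compatible : compatible dot An H2.
Proof.
have [V' VV'] := adjoint_pair_elim_map dot_norm v posA n.
have PP := adjoint_pair_orthoproj dot_norm proj1.
have QQ' := adjoint_pair_sub (adjoint_pair_id dot) (adjoint_pair_comp VV' PP).
have [bQ _ _] := QQ'; have [[VL _] _ _] := VV'.
pose Q h := h - W h; exists Q.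
have Q_id y : H2 y -> Q y = y.
  by move=> H2y; rewrite /Q /graph_map orthoproj_eq0_H2// (linear_apply0 VL) subr0.
split=> //.
- by apply/funext => h /=; rewrite Q_id//; exact: graph_map_complement.
- apply/seteqP; split=> [_ [h _ <-]|y H2y]; first exact: graph_map_complement.
  by exists y => //; exact: Q_id.
have [_ sAn _] := truncated_positive; have [[AnL _] _ _] := truncated_positive.
have [_ sT _] := short_truncated_positive.
have AnQ h : An (Q h) = An h - T h.
  by rewrite (zmod_morphism_linear AnL) truncated_graph_map.
rewrite (adjointE QQ').
apply/funext => y; apply: (dot_inj (dot := dot)) => x.
have [_ _ QE] := QQ'; rewrite [RHS]dotC -QE -dotC.
rewrite -[LHS]/'[An (Q y), x] -[RHS]/'[An y, Q x].
by rewrite [RHS]sAn !AnQ dotBl dotBr sAn sT.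
Qed.

End Truncation.

Lemma shorted_truncated_cvg :
  wot_cvg dot (fun n => shorted dot (truncated dot A H1 e I n) H1)
              (shorted dot A H1).
Proof.
have [B [pB SB BS]] := nonincreasing_cvg_strong dot_norm
  (schur_positive dot_norm v posA) (schur_nonincreasing dot_norm v posA).
rewrite (shorted_schur_limit pB SB BS) => h g.
have -> : (fun n => '[shorted dot (truncated dot A H1 e I n) H1 h, g]) =
    fun n => '[schur dot A v n (P1 h), P1 g].
  by apply/funext => n; rewrite shorted_truncated dot_short_truncated.
have [_ _ BH1] := schur_limit_candidate pB BS.
have [[BL _] sB _] := pB.
have BP x : B x = B (P1 x).
  apply/eqP; rewrite -subr_eq0 -(zmod_morphism_linear BL).
  by rewrite (positive_range_ker pB BH1 (split_complement _ splitH)).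
by rewrite BP sB BP -sB; exact: cvg_dotl.
Qed.

End ShortedTruncations.

Theorem theorem3p1 (R : realType) (k : scalars)
    (H : completeNormedModType (scalar_field R k))
    (dot : {dot H for @scalar_conj R k})
    (dot_norm : induces_norm dot)
    (sepH : separable H)
    (A : H -> H) (posA : positive_operator dot A)
    (H1 H2 : set H) (splitH : hilbert_split dot H1 H2)
    (e : nat -> H) (I : set nat)
    (basis_e : ordered_orthonormal_basis dot H2 e I) :
  (forall n : nat, (0 < n)%N ->
     positive_operator dot (truncated dot A H1 e I n) /\
     compatible dot (truncated dot A H1 e I n) H2) /\
  wot_cvg dot (fun n => shorted dot (truncated dot A H1 e I n) H1)
              (shorted dot A H1).
Proof.
split=> [n _|]; last exact: shorted_truncated_cvg basis_e.
split; first exact: truncated_positive basis_e n.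
exact: truncated_compatible basis_e n.
Qed.
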